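(* In the AI-augmented cascade model with symmetric prior $\ell_0=0$, private accuracy $q\in(\tfrac12,1)$ and AI accuracy $\alpha\in(\tfrac12,1)$, let $$W^{+}=\Pr(D_\infty=\theta\mid c=\theta),\qquad W^{-}=\Pr(D_\infty=\theta\mid c\ne\theta).$$ Then the pair $(W^+,W^-)$ depends on $\alpha$ only through whether $\alpha\ge q$ or $\alpha<q$: $$(W^{+},W^{-})=\begin{cases}(1,\,0), & \alpha\ge q,\\[6pt] \left(\dfrac{q}{1-q+q^2},\ \dfrac{q^2}{1-q+q^2}\right), & \tfrac12<\alpha<q.\end{cases}$$
   Context: AI-augmented cascade model. A binary state $\theta\in\{0,1\}$ has prior $\pi_0=\Pr(\theta=1)$, $\ell_0=\log\frac{\pi_0}{1-\pi_0}$. Users $i=1,2,\dots$ act sequentially. User $i$ has a private signal $s_i\in\{0,1\}$ with $\Pr(s_i=\theta\mid\theta)=q$; there is one common AI signal $c\in\{0,1\}$ with $\Pr(c=\theta\mid\theta)=\alpha$, seen by every user; given $\theta$, the variables $c,s_1,s_2,\dots$ are mutually independent. User $i$ observes $s_i$, $c$ and the public history $(J_1,\dots,J_{i-1})$. Write $L_\rho=\log\frac{\rho}{1-\rho}$ and $\lambda(x;\rho)=(2x-1)L_\rho$ for $x\in\{0,1\}$. The public log-odds are $P_i=\ell_0+\lambda(c;\alpha)+\sum_{j<i}\psi_j(J_j)$, where $\psi_j(J_j)=\log\frac{\Pr(J_j\mid\theta=1,P_j)}{\Pr(J_j\mid\theta=0,P_j)}$ (probabilities conditional on the public log-odds $P_j$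 under which user $j$ acted). User $i$'s posterior log-odds are $\ell_i=P_i+\lambda(s_i;q)$, and her judgment is $J_i=1$ if $\ell_i>0$, $J_i=0$ if $\ell_i<0$, and $J_i=\mathbf 1\{P_i\ge0\}$ if $\ell_i=0$. The final cascade direction is $D_\infty=\lim_{i\to\infty}\operatorname{sign}(P_i)\in\{-1,+1\}$ ($+1$ if $(P_i)$ is absorbed in $\{P\ge L_q\}$, $-1$ if absorbed in $\{P\le-L_q\}$; absorption occurs almost surely). The event ''$D_\infty=\theta$'' means that the cascade direction is correct, i.e. $D_\infty=2\theta-1$. *)

(* Defs.v *)
From mathcomp Require Import all_boot all_order all_algebra finmap.
From mathcomp Require Import all_classical all_reals all_analysis.

Set Implicit Arguments.
Unset Strict Implicit.
Unset Printing Implicit Defensive.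

Import Order.TTheory GRing.Theory Num.Theory.
Import numFieldNormedType.Exports.

Local Open Scope classical_set_scope.
Local Open Scope ring_scope.

Definition log_odds (R : realType) (rho : R) : R := ln (rho / (1 - rho)).

Definition llr (R : realType) (x : bool) (rho : R) : R :=
  (2 * x%:R - 1) * log_odds rho.

Definition judgment (R : realType) (p l : R) : bool :=
  if l == 0 then 0 <= p else 0 < l.

Section Conditioning.
Context (d : measure_display) (T : measurableType d) (R : realType).
Variable mu : probability T R.

(* Elementary conditional probability; only meaningful when [B] has positive
   probability. *)
Definition cond_prob (A B : set T) : R :=
  fine (mu (A `&` B)) / fine (mu B).

Definition cond_mutual_indep (I : choiceType) (d' : measure_display)
    (U : measurableType d') (X : I -> T -> U) (E : set T) : Prop :=
  forall (J : {fset I}) (B : I -> set U),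
    (forall i, i \in J -> measurable (B i)) ->
    cond_prob (\bigcap_(i in [set` J]) X i @^-1` B i) E =
    \prod_(i <- J) cond_prob (X i @^-1` B i) E.

End Conditioning.

Section Cascade.
Context (d : measure_display) (T : measurableType d) (R : realType).
Variable mu : probability T R.

(* Users are numbered from 0: [s i] is the private signal of the (i+1)-st user.
   The family "c, s_1, s_2, ..." is indexed by [option nat], with [None] for
   [c]. *)
Record cascade_signals (pi0 q alpha : R) (theta c : {RV mu >-> bool})
    (s : nat -> {RV mu >-> bool}) : Prop := CascadeSignals {
  prior_law : fine (mu [set w | theta w = true]) = pi0;
  ai_law : forall t : bool,
    cond_prob mu [set w | c w = theta w] [set w | theta w = t] = alpha;
  private_law : forall (i : nat) (t : bool),
    cond_prob mu [set w | s i w = theta w] [set w | theta w = t] = q;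
  signals_indep : forall t : bool,
    cond_mutual_indep mu
      (fun k : option nat => if k is Some i then s i : T -> bool else c)
      [set w | theta w = t]
}.

Variables (pi0 q alpha : R) (theta c : T -> bool) (s : nat -> T -> bool).

(* log (Pr(J = x | theta = 1, X = p) / Pr(J = x | theta = 0, X = p)), evaluated
   at the realized values p = X w and x = J w. *)
Definition judgment_llr (X : T -> R) (J : T -> bool) (w : T) : R :=
  let likelihood (t : bool) :=
    cond_prob mu [set v | J v = J w] [set v | theta v = t /\ X v = X w] in
  ln (likelihood true / likelihood false).

Definition user_judgment (X : T -> R) (i : nat) (w : T) : bool :=
  judgment (X w) (X w + llr (s i w) q).

(* The public log-odds under which user [i] acts; see [public_log_oddsE] for the
   closed form. *)
Fixpoint public_log_odds (i : nat) : T -> R :=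
  if i is j.+1 then
    let X := public_log_odds j in
    fun w => X w + judgment_llr X (user_judgment X j) w
  else fun w => log_odds pi0 + llr (c w) alpha.

Lemma public_log_oddsE (i : nat) (w : T) :
  public_log_odds i w = log_odds pi0 + llr (c w) alpha +
    \sum_(j < i) judgment_llr (public_log_odds j)
                   (user_judgment (public_log_odds j) j) w.
Proof.
elim: i => [|i IH]; first by rewrite big_ord0 addr0.
by rewrite big_ord_recr /= {1}IH addrA.
Qed.

Definition cascade_direction (w : T) : R :=
  limn (fun i => Num.sg (public_log_odds i w)).

(* Where the signs do not converge (a null event in the model), the
   direction is the default value 0, so it is neither correct nor incorrect. *)
Lemma cascade_direction_dvg (w : T) :
  ~ cvgn (fun i => Num.sg (public_log_odds i w)) -> cascade_direction w = 0.
Proof. by move=> dvg; rewrite /cascade_direction dvgP. Qed.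

Definition correct_cascade : set T :=
  [set w | cascade_direction w = 2 * (theta w)%:R - 1].

Definition W_plus : R :=
  cond_prob mu correct_cascade [set w | c w = theta w].

Definition W_minus : R :=
  cond_prob mu correct_cascade [set w | c w <> theta w].

End Cascade.

(* Main.v *)
(** A judgment reveals the private signal exactly when [|P| < L_q], and carries
    no information otherwise; so, conditioning on [P], the public log-odds are a
    walk with steps [+-L_q] stopped on leaving [(-L_q, L_q)].  Multiplying by
    [2 theta - 1], only the indicators "signal [n] equals [theta]" matter: they
    are independent, and the walk starts at [+-L_alpha].  If [alpha >= q] it is
    stopped at once.  If [alpha < q], from [e] in [(0, L_q)] it is absorbed
    upwards iff the indicators read [(0 1)^n 1] for some [n], an event of
    probability [sum_n (q (1 - q))^n q = q / (1 - q + q^2)]; from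
    [e - L_q] one extra correct signal is needed first. *)

Require Import Defs.
From mathcomp Require Import all_boot all_order all_algebra finmap.
From mathcomp Require Import all_classical all_reals all_analysis.
From mathcomp Require Import zify ring lra.

Set Implicit Arguments.
Unset Strict Implicit.
Unset Printing Implicit Defensive.

Import Order.TTheory GRing.Theory Num.Theory.
Import numFieldNormedType.Exports.

Local Open Scope classical_set_scope.
Local Open Scope ring_scope.

(** * Limits of signs and log-odds *)

(** A divergent sequence gets the default limit [0], so a nonzero value of [limn] certifies
    convergence. *)
Lemma limn_neq0P (R : realType) (u : nat -> R) (l : R) :
  l != 0 -> limn u = l <-> u @ \oo --> l.
Proof.
move=> l0; split=> [ul|]; last exact: cvg_lim.
have [cu|/dvgP du] := pselect (cvgn u); first by rewrite -ul.
by rewrite -ul du eqxx in l0.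
Qed.

Lemma log_odds_gt0 (R : realType) (r : R) : 2^-1 < r < 1 -> 0 < log_odds r.
Proof.
move=> /andP[r2 r1]; apply: ln_gt0.
by rewrite ltr_pdivlMr; lra.
Qed.

Lemma le_log_odds (R : realType) (r r' : R) :
  0 < r < 1 -> 0 < r' < 1 -> (log_odds r <= log_odds r') = (r <= r').
Proof.
move=> /andP[r0 r1] /andP[r'0 r'1]; rewrite /log_odds ler_ln.
- rewrite ler_pdivrMr ?subr_gt0// mulrAC ler_pdivlMr ?subr_gt0//.
  by rewrite !mulrBr !mulr1 (mulrC r' r) lerD2r.
- by rewrite posrE divr_gt0 ?subr_gt0.
- by rewrite posrE divr_gt0 ?subr_gt0.
Qed.

Lemma llrE (R : realType) (x : bool) (r : R) :
  llr x r = if x then log_odds r else - log_odds r.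
Proof. by rewrite /llr; case: x => /=; ring. Qed.

Lemma llr_negb (R : realType) (x : bool) (r : R) : llr (~~ x) r = - llr x r.
Proof. by rewrite !llrE; case: x; rewrite /= ?opprK. Qed.

(** These are the prefixes that bring a walk started in [(0, L)] back to its start without
    absorption. *)
Definition alternates (b : nat -> bool) (n : nat) :=
  forall k, (k < n)%N -> b k.*2 = false /\ b k.*2.+1 = true.

Lemma alternatesS b n : alternates b n.+1 <->
  alternates b n /\ b n.*2 = false /\ b n.*2.+1 = true.
Proof.
split=> [bS|[bn b2n] k]; first by split=> [k kn|]; apply: bS; lia.
by rewrite ltnS leq_eqVlt => /predU1P[->|/bn].
Qed.

(** * The stopped walk and its absorption, for a fixed signal sequence *)

Section Walk.
Context (R : realType) (q : R).
Local Notation L := (log_odds q).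

(** The strict bound reflects the tie rule: at [|p| = L] a judgment no longer depends on the signal,
    so the walk has stopped there. *)
Fixpoint walk (y : R) (b : nat -> bool) (i : nat) : R :=
  if i is j.+1 then
    let p := walk y b j in p + (if `|p| < L then llr (b j) q else 0)
  else y.

Lemma walk_addn y b m i :
  walk y b (m + i) = walk (walk y b m) (fun k => b (m + k)%N) i.
Proof. by elim: i => [|i IH]; rewrite ?addn0// addnS /= IH. Qed.

Lemma eq_walk y b b' i :
  (forall k, (k < i)%N -> b k = b' k) -> walk y b i = walk y b' i.
Proof.
elim: i => //= i IH bb'; rewrite bb'// IH// => k ki.
by rewrite bb'// ltnW.
Qed.

(** This symmetry reduces the state [theta = false] to [theta = true]. *)
Lemma walkN y b i : walk (- y) (fun k => ~~ b k) i = - walk y b i.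
Proof.
elim: i => //= i ->; rewrite normrN llr_negb opprD.
by case: ifP => // _; rewrite oppr0.
Qed.

Lemma walk_absorbed y b i : L <= `|y| -> walk y b i = y.
Proof. by move=> Ly; elim: i => //= i ->; rewrite ltNge Ly addr0. Qed.

(** Absorption is expressed through signs to match [cascade_direction]; a walk that is never
    absorbed has to be excluded separately, by the oscillation of its signs. *)
Definition rises y b := (fun i => Num.sg (walk y b i)) @ \oo --> (1 : R).

Lemma rises_shift m y b :
  rises y b <-> rises (walk y b m) (fun k => b (m + k)%N).
Proof.
rewrite /rises -(cvg_shiftn m (fun i => Num.sg (walk y b i))) /=.
suff -> : (fun i => Num.sg (walk y b (i + m))) =
  (fun i => Num.sg (walk (walk y b m) (fun k => b (m + k)%N) i)) by [].
by apply/funext => i; rewrite addnC walk_addn.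
Qed.

Lemma rises_absorbed y b : L <= `|y| -> rises y b <-> 0 < y.
Proof.
move=> Ly; rewrite /rises.
have -> : (fun i => Num.sg (walk y b i)) = cst (Num.sg y).
  by apply/funext => i; rewrite walk_absorbed.
split=> [sy|/gtr0_sg ->]; last exact: cvg_cst.
rewrite -sgr_gt0 (_ : Num.sg y = 1) //.
by apply: (cvg_unique _ (cvg_cst _) sy); exact: Rhausdorff.
Qed.

Lemma walk1 y b : `|y| < L -> walk y b 1 = y + llr (b 0%N) q.
Proof. by move=> /= ->. Qed.

Lemma walk2_false_true (e : R) b : 0 < e < L -> b 0%N = false -> b 1%N = true ->
  walk e b 2 = e.
Proof.
move=> /andP[e0 eL] b0 b1 /=; rewrite gtr0_norm// eL b0 b1 !llrE.
by rewrite ltr0_norm; [rewrite ifT; lra|lra].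
Qed.

Lemma walk_alternates (e : R) b n : 0 < e < L -> alternates b n ->
  walk e b n.*2 = e.
Proof.
move=> eL; elim: n => // n IH /alternatesS[bn [b0 b1]].
rewrite doubleS -addn2 walk_addn IH//; apply: walk2_false_true => //.
  by rewrite addn0.
by rewrite addn1.
Qed.

(** Under alternation the walk is at [e] at even times and at [e - L] at odd times. A [true] at [e]
    leads to [e + L], absorbed above; a [false] at [e - L] leads to [e - 2 L < - L], absorbed below.
    So a rising walk that never reads [true] at an even time would alternate forever. *)
Lemma risesE (e : R) b : 0 < e < L ->
  rises e b <-> exists n, alternates b n /\ b n.*2 = true.
Proof.
move=> eL; have /andP[e0 eL'] := eL; split; last first.
  move=> [n [bn b2n]]; apply/(rises_shift n.*2.+1); rewrite -addn1.
  rewrite walk_addn walk_alternates// walk1 ?gtr0_norm// addn0 b2n llrE.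
  by apply/rises_absorbed; rewrite ?gtr0_norm; lra.
move=> eb; apply: contrapT => noup.
have alt n : alternates b n.
  elim: n => // n IH; apply/alternatesS; split=> //.
  have bn0 : b n.*2 = false.
    by apply/negbTE/negP => bn; apply: noup; exists n.
  split=> //; apply: contrapT => /negP/negbTE bn1.
  move/(rises_shift (n.*2 + 2)): eb.
  rewrite walk_addn walk_alternates//= addn0 addn1 bn0 bn1 !llrE.
  rewrite (gtr0_norm e0) eL' ltr0_norm; last lra.
  rewrite ifT; last lra.
  by rewrite rises_absorbed; [move=> ?|rewrite ltr0_norm]; lra.
(* At the odd time [2 N + 1] the walk is at [e - L < 0]: its sign is at distance 2 from the supposed
   limit [1]. *)
have /cvgrPdist_lt /(_ 1 ltr01)[N _ /(_ N.*2.+1)] := eb.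
rewrite /= walk_alternates// (gtr0_norm e0) eL' (alt N.+1 N _).1// llrE.
rewrite ltr0_sg; last lra.
have nN : (N <= N.*2.+1)%N by lia.
by move=> /(_ nN); rewrite opprK ger0_norm; [move=> ?|]; lra.
Qed.

(* From [- e], a correct signal leads to [L_q - e], again in [(0, L_q)]. *)
Lemma rises_opp (e : R) b : 0 < e < L ->
  rises (- e) b <-> b 0%N = true /\
    exists n, alternates (fun k => b k.+1) n /\ b n.*2.+1 = true.
Proof.
move=> /andP[e0 eL].
have e1 : `|- e| < L by rewrite normrN gtr0_norm.
rewrite (rises_shift 1) walk1// llrE; case: (b 0%N) => /=.
  by rewrite risesE; [split=> [|[]]|lra].
by split=> [|[]//]; rewrite rises_absorbed; [move=> ?|rewrite ltr0_norm]; lra.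
Qed.

End Walk.

(** * Elementary probability *)

Definition bern (R : realType) (r : R) (x : bool) : R := if x then r else 1 - r.

Section Probability.
Context (d : measure_display) (T : measurableType d) (R : realType).
Context (mu : probability T R).

Definition pr (A : set T) : R := fine (mu A).

Lemma pr0 : pr set0 = 0.
Proof. by rewrite /pr measure0. Qed.

Lemma prU (A B : set T) : measurable A -> measurable B -> A `&` B = set0 ->
  pr (A `|` B) = pr A + pr B.
Proof.
by move=> mA mB AB; rewrite /pr measureU// fineD// fin_num_measure.
Qed.

Lemma pr_split (f : T -> bool) (A : set T) :
  measurable (A `&` [set w | f w = true]) ->
  measurable (A `&` [set w | f w = false]) ->
  pr A = pr (A `&` [set w | f w = true]) + pr (A `&` [set w | f w = false]).
Proof.
move=> mt mf; rewrite -prU//.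
  by congr pr; apply/seteqP; split=> w /=; case: (f w); tauto.
by apply/seteqP; split=> w //= -[[_ ->] []].
Qed.

Lemma le_pr (A B : set T) : measurable A -> measurable B -> A `<=` B ->
  pr A <= pr B.
Proof.
move=> mA mB AB; rewrite fine_le ?fin_num_measure//.
by rewrite le_measure ?inE.
Qed.

(** By countable additivity, the probabilities sum as a geometric series. *)
Lemma pr_geometric (F : nat -> set T) (a x : R) : 0 <= x < 1 ->
  (forall n, measurable (F n)) -> trivIset setT F ->
  (forall n, pr (F n) = a * x ^+ n) ->
  pr (\bigcup_n F n) = a / (1 - x).
Proof.
move=> /andP[x0 x1] mF tF prF.
have mUF : measurable (\bigcup_n F n) by exact: bigcupT_measurable.
rewrite /pr.
have -> : mu (\bigcup_n F n) = (a / (1 - x))%:E; last by [].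
have := @measure_semi_sigma_additive _ _ _ mu F mF tF mUF.
move/cvg_unique; apply; first exact: ereal_hausdorff.
rewrite (_ : (fun _ => _) = (fun n => (series (geometric a x) n)%:E)).
  apply: cvg_EFin; first by near=> n.
  by apply: cvg_geometric_series; rewrite ger0_norm.
apply/funext => n; rewrite -sumEFin; apply: eq_bigr => k _.
by rewrite /geometric /= -prF /pr fineK// fin_num_measure.
Unshelve. all: by end_near.
Qed.

End Probability.

(** * Independence of the hits *)

Section Signals.
Context (d : measure_display) (T : measurableType d) (R : realType).
Context (mu : probability T R) (pi0 q alpha : R).
Context (theta c : {RV mu >-> bool}) (s : nat -> {RV mu >-> bool}).
Context (pi0_itv : 0 < pi0 < 1) (q_itv : 2^-1 < q < 1).
Context (alpha_itv : 2^-1 < alpha < 1).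
Context (signals : cascade_signals pi0 q alpha theta c s).

Local Notation pr := (pr mu).

(* The AI signal counts as signal number 0, so that private signal [i] is
   number [i.+1]. *)
Definition signal (n : nat) : {RV mu >-> bool} := if n is i.+1 then s i else c.

Definition accuracy (n : nat) : R := if n is _.+1 then q else alpha.

(** The signals are independent only given [theta], whereas the hits have the same law under both
    states, hence are independent of [theta] and of each other. *)
Definition hit (n : nat) (w : T) : bool := signal n w == theta w.

Lemma accuracy_itv n : 0 < accuracy n < 1.
Proof.
have /andP[q2 q1] := q_itv; have /andP[a2 a1] := alpha_itv.
by case: n => [|n] /=; apply/andP; split; lra.
Qed.

Lemma bern_accuracy_gt0 n x : 0 < bern (accuracy n) x.
Proof. by have /andP[] := accuracy_itv n; case: x => /=; lra. Qed.

Lemma measurable_theta t : measurable [set w | theta w = t].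
Proof. exact: (measurable_funPTI theta (Y := [set t])). Qed.

Lemma measurable_signal n x : measurable [set w | signal n w = x].
Proof. exact: (measurable_funPTI (signal n) (Y := [set x])). Qed.

Lemma pr_theta_gt0 t : 0 < pr [set w | theta w = t].
Proof.
have /andP[pi0_gt0 pi0_lt1] := pi0_itv.
have prT : pr [set w | theta w = true] = pi0 by exact: prior_law signals.
case: t; first by rewrite prT; lra.
have := @pr_split _ _ _ mu theta setT; rewrite !setTI prT.
move=> /(_ (measurable_theta _) (measurable_theta _)).
by rewrite {1}/pr probability_setT /=; lra.
Qed.

(** Given [theta = t], the signal value [x == t] is the one for which the hit is [x]. The case
    [x = false] follows from [x = true] by complement. *)
Lemma cond_prob_signal t n x :
  cond_prob mu [set w | signal n w = (x == t)] [set w | theta w = t] =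
  bern (accuracy n) x.
Proof.
set E := [set w | theta w = t]; have E0 := pr_theta_gt0 t.
have hitE : pr ([set w | signal n w = t] `&` E) = accuracy n * pr E.
  have : cond_prob mu [set w | signal n w = theta w] E = accuracy n.
    by case: n => [|n]; [apply: ai_law signals t|apply: private_law signals n t].
  rewrite /cond_prob => <-; rewrite divfK ?gt_eqF//; congr pr.
  by apply/seteqP; split=> w /= [wt wE]; split; congruence.
suff : pr ([set w | signal n w = (x == t)] `&` E) =
    bern (accuracy n) x * pr E.
  by rewrite /pr /cond_prob => ->; rewrite mulfK// gt_eqF.
case: x; first by rewrite /= -hitE; case: (t).
rewrite /= mulrBl mul1r -hitE.
have := @pr_split _ _ _ mu (fun w => signal n w == t) E.
have -> : E `&` [set w | (signal n w == t) = true] =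
    [set w | signal n w = t] `&` E.
  by apply/seteqP; split=> w /= [] => [? /eqP|/eqP].
have -> : E `&` [set w | (signal n w == t) = false] =
    [set w | signal n w = (false == t)] `&` E.
  by apply/seteqP; split=> w /=; case: (signal n w) (t) => -[] //= [].
move=> -> //; first by rewrite addrAC subrr add0r.
- by apply: measurableI; [exact: measurable_signal|exact: measurable_theta].
- by apply: measurableI; [exact: measurable_signal|exact: measurable_theta].
Qed.

Definition cyl (t : bool) (f : nat -> bool) (n : nat) : set T :=
  [set w | theta w = t /\ forall i, (i < n)%N -> hit i w = f i].

(** Given [theta = t], prescribing hits amounts to prescribing signals, so conditional independence
    gives the product. Its factors do not involve [t]. *)
Lemma pr_cyl t f n :
  pr (cyl t f n) =
  pr [set w | theta w = t] * \prod_(i < n) bern (accuracy i) (f i).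
Proof.
(* [key] and [rank] translate between signal numbers and the indices [option nat] of
   [signals_indep]. *)
pose key i := if i is j.+1 then Some j else None.
pose rank k := if k is Some j then j.+1 else 0%N.
have keyK : cancel key rank by case.
pose K := [fset k in [seq key i | i <- iota 0 n]]%fset.
pose B k := [set f (rank k) == t].
have := signals_indep signals t (J := K) (B := B) (fun k _ => I).
rewrite /cond_prob -/(pr _) -/(pr _).
have -> : (\bigcap_(k in [set` K])
    (if k is Some i then s i : T -> bool else c) @^-1` B k) `&`
    [set w | theta w = t] = cyl t f n.
  apply/seteqP; split=> w /=.
    move=> [Kw wt]; split=> // i ni.
    have /Kw : key i \in K by rewrite !inE map_f// mem_iota.
    rewrite /B /= keyK /hit wt => wi.
    have -> : signal i w = (f i == t) by case: (i) wi.
    by case: (f i) (t) => -[].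
  move=> [wt wf]; split=> // k /=.
  rewrite !inE => /mapP[i]; rewrite mem_iota /= => ni ->.
  rewrite /B /= keyK -(wf i ni) /hit wt.
  suff -> : signal i w = (if key i is Some j then s j : T -> bool else c) w.
    by case: ((if key i is Some j then s j : T -> bool else c) w) (t) => -[].
  by case: (i).
move/(canRL (mulfVK _)) => ->; last by rewrite gt_eqF// pr_theta_gt0.
rewrite mulrC; congr (_ * _).
rewrite (perm_big [seq key i | i <- iota 0 n]); last first.
  apply: uniq_perm; rewrite ?fset_uniq//.
    by rewrite (map_inj_uniq (can_inj keyK)) iota_uniq.
  by move=> k; rewrite !inE.
rewrite big_map -[n in iota 0 n]subn0 big_mkord; apply: eq_bigr => i _.
rewrite -(cond_prob_signal t) /B keyK.
by congr (cond_prob _ _ _); case: (val i).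
Qed.

Lemma pr_cyl_gt0 t f n : 0 < pr (cyl t f n).
Proof.
rewrite pr_cyl mulr_gt0 ?pr_theta_gt0// prodr_gt0// => i _.
exact: bern_accuracy_gt0.
Qed.

Lemma measurable_hit n x : measurable [set w | hit n w = x].
Proof.
have -> : [set w | hit n w = x] = \bigcup_(t in [set: bool])
    ([set w | theta w = t] `&` [set w | signal n w = (x == t)]).
  apply/seteqP; split=> w /=; rewrite /hit.
    by move=> <-; exists (theta w) => //=; case: (signal n w) (theta w) => -[].
  by move=> [t _ [<- ->]]; case: (x) (theta w) => -[].
apply: fin_bigcup_measurable => // t _.
by apply: measurableI; [exact: measurable_theta|exact: measurable_signal].
Qed.

Lemma cylS t f n : cyl t f n.+1 = cyl t f n `&` [set w | hit n w = f n].
Proof.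
apply/seteqP; split=> w /= [].
  by move=> wt wf; split; [split=> // i ni|]; apply: wf; lia.
move=> [wt wf] wn; split=> // i.
by rewrite ltnS leq_eqVlt => /predU1P[->|/wf].
Qed.

Lemma measurable_cyl t f n : measurable (cyl t f n).
Proof.
elim: n => [|n IH]; last first.
  by rewrite cylS; apply: measurableI => //; exact: measurable_hit.
rewrite (_ : cyl t f 0 = [set w | theta w = t]); first exact: measurable_theta.
by apply/seteqP; split=> w //= [].
Qed.

(** A pointwise form of membership in the finite sigma-algebra generated by [theta] and the first
    [n] hits; measurability is then derived in [determined_indep]. *)
Definition determined (n : nat) (A : set T) := forall w w',
  theta w = theta w' -> (forall i, (i < n)%N -> hit i w = hit i w') ->
  A w -> A w'.

(* Backward induction on the cylinder length [m]: for [m = n] the cylinder is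
   contained in [A] or disjoint from it, and shorter ones are split in two. *)
Lemma determined_cyl n A t f k m : determined n A -> (m + k)%N = n ->
  measurable (cyl t f m `&` A) /\
  forall x, pr (cyl t f m `&` A `&` [set w | hit n w = x]) =
            bern (accuracy n) x * pr (cyl t f m `&` A).
Proof.
move=> An; elim: k m f => [|k IH] m f.
  rewrite addn0 => ->.
  have [[w [[wt wf] Aw]]|noA] := pselect (exists w, (cyl t f n `&` A) w).
    have -> : cyl t f n `&` A = cyl t f n.
      apply/seteqP; split=> w' //=; first by case.
      move=> [w't w'f]; split=> //; apply: An Aw; first by rewrite wt.
      by move=> i ni; rewrite wf// w'f.
    split=> [|x]; first exact: measurable_cyl.
    pose f' i := if i == n then x else f i.
    have ff' i : (i < n)%N -> f' i = f i by rewrite /f' => ni; rewrite ltn_eqF.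
    have <- : cyl t f' n = cyl t f n.
      by apply/seteqP; split=> v [vt vf]; split=> // i ni; rewrite vf// ff'.
    have {1}<- : f' n = x by rewrite /f' eqxx.
    rewrite -cylS !pr_cyl big_ord_recr /= /f' eqxx; ring.
  have -> : cyl t f n `&` A = set0.
    by apply/seteqP; split=> w // Aw; apply: noA; exists w.
  by split=> [|x]; [exact: measurable0|rewrite set0I pr0 mulr0].
rewrite addnS -addSn => mkn.
pose g x i := if i == m then x else f i.
have cylg x : cyl t (g x) m.+1 = cyl t f m `&` [set w | hit m w = x].
  rewrite cylS {2}/g eqxx; congr (_ `&` _).
  by apply/seteqP; split=> v [vt vf]; split=> // i ni;
    rewrite vf// /g ltn_eqF.
have cylE : cyl t f m `&` A =
    (cyl t (g true) m.+1 `&` A) `|` (cyl t (g false) m.+1 `&` A).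
  rewrite !cylg; apply/seteqP; split=> w /=; last by tauto.
  by case: (hit m w); tauto.
have disj B : (cyl t (g true) m.+1 `&` A `&` B) `&`
    (cyl t (g false) m.+1 `&` A `&` B) = set0.
  by rewrite !cylg; apply/seteqP; split=> w //= -[[[[_ ->] _] _] [[[]]]].
have [mt IHt] := IH _ (g true) mkn; have [mf IHf] := IH _ (g false) mkn.
rewrite cylE; split=> [|x]; first exact: measurableU.
rewrite setIUl !prU//.
- by rewrite IHt IHf mulrDr.
- by have := disj setT; rewrite !setIT.
- by apply: measurableI => //; exact: measurable_hit.
- by apply: measurableI => //; exact: measurable_hit.
Qed.

Lemma determined_indep n A : determined n A ->
  measurable A /\
  forall x, pr (A `&` [set w | hit n w = x]) = bern (accuracy n) x * pr A.
Proof.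
(* The choice of [f] is immaterial: a cylinder of length 0 only fixes [theta]. *)
move=> An; pose f := fun _ : nat => true.
have cylE t : cyl t f 0 `&` A = A `&` [set w | theta w = t].
  by apply/seteqP; split=> w /= [] => [[]|].
have [[mt At] [mf Af]] : (_ /\ _) /\ (_ /\ _) := conj
  (determined_cyl true f An (add0n n))
  (determined_cyl false f An (add0n n)).
rewrite !cylE in mt At mf Af.
have mA : measurable A.
  rewrite (_ : A = (A `&` [set w | theta w = true]) `|`
    (A `&` [set w | theta w = false])); first exact: measurableU.
  by apply/seteqP; split=> w /=; case: (theta w); tauto.
split=> // x; rewrite (pr_split mu mt mf) mulrDr -At -Af.
rewrite (setIAC A [set w | theta w = true]).
rewrite (setIAC A [set w | theta w = false]) -pr_split// setIAC;
  by apply: measurableI => //; exact: measurable_hit.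
Qed.

Lemma judgment_active (p : R) (x : bool) : `|p| < log_odds q ->
  judgment p (p + llr x q) = x.
Proof.
rewrite ltr_norml => /andP[pl pu]; rewrite /judgment llrE; case: x.
  have l0 : 0 < p + log_odds q by lra.
  by rewrite gt_eqF.
have l0 : p - log_odds q < 0 by lra.
by rewrite lt_eqF// ltNge ltW.
Qed.

(** On the boundary [|p| = L_q] an opposing signal produces a tie, which is resolved by the sign of
    [p]; the boundary therefore belongs to the cascade. *)
Lemma judgment_absorbed (p : R) (x : bool) : log_odds q <= `|p| ->
  judgment p (p + llr x q) = (0 < p).
Proof.
have L0 := log_odds_gt0 q_itv.
have [xq qx] : - log_odds q <= llr x q /\ llr x q <= log_odds q.
  by rewrite llrE; case: x; split; lra.
rewrite ler_normr => /orP pL; rewrite /judgment.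
case: eqVneq => l0; apply/idP/idP => p0; case: pL => pL; lra.
Qed.

Lemma ln_bern_ratio (x : bool) :
  ln (bern q (x == true) / bern q (x == false)) = llr x q.
Proof.
have /andP[q2 q1] := q_itv.
rewrite llrE; case: x => //=.
by rewrite -[LHS]opprK -lnV ?invf_div// posrE divr_gt0//; lra.
Qed.

(** * The log-likelihood ratio of a judgment *)

Section Likelihood.
(** [X] is any function of the AI signal and the private signals before that of user [i] (numbers
    [0] to [i]), so that the result can be used inside the induction computing the public
    log-odds. *)
Context (i : nat) (X : T -> R) (w : T).
Context (X_signal : forall v v',
  (forall k, (k < i.+1)%N -> signal k v = signal k v') -> X v = X v').

Let A t := [set v | theta v = t /\ X v = X w].

Lemma determined_likelihood t : determined i.+1 (A t).
Proof.
move=> v v' vv' hh [vt vw]; split; first by rewrite -vv'.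
rewrite /= -vw; apply: X_signal => k /hh; rewrite /hit vv'.
by case: (signal k v) (signal k v') (theta v') => -[] [].
Qed.

(** The value [X w] is possible under both states: [A t] contains the cylinder on which signals [0]
    to [i] repeat their values at [w], even when [t] differs from [theta w]. This makes the
    conditional probabilities in [judgment_llr] meaningful. *)
Lemma pr_likelihood_gt0 t : 0 < pr (A t).
Proof.
apply: lt_le_trans (pr_cyl_gt0 t (fun k => signal k w == t) i.+1) _.
apply: le_pr; first exact: measurable_cyl.
  by have [] := determined_indep (@determined_likelihood t).
move=> v [vt vf]; split=> //; apply: X_signal => k /vf; rewrite /hit vt.
by case: (signal k v) (signal k w) (t) => -[] [].
Qed.

Lemma judgment_llrE :
  judgment_llr mu theta X (user_judgment q (fun i => s i) X i) w =
  if `|X w| < log_odds q then llr (s i w) q else 0.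
Proof.
have A0 t : pr (A t) != 0 by rewrite gt_eqF// pr_likelihood_gt0.
rewrite /judgment_llr /user_judgment /=; case: ltP => Xw.
  rewrite -[RHS]ln_bern_ratio.
  suff llE t : cond_prob mu [set v | judgment (X v) (X v + llr (s i v) q) =
      judgment (X w) (X w + llr (s i w) q)]
      [set v | theta v = t /\ X v = X w] = bern q (s i w == t).
    by rewrite !llE.
  (* On [A t] the judgment reveals the private signal, so repeating the judgment at [w] means that
     hit [i.+1], independent of [A t], equals [s i w == t]. *)
  have [_ /(_ (s i w == t)) iA] := determined_indep (@determined_likelihood t).
  rewrite /cond_prob -[bern _ _](mulfK (A0 t)) -iA; congr (fine (mu _) / _).
  apply/seteqP; split=> v /=.
    move=> [+ [vt vw]]; rewrite vw !judgment_active// => vs.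
    by do !split=> //; rewrite /hit /= vs vt.
  move=> [[vt vw]]; rewrite /hit /= vt => vs; split=> //.
  rewrite vw !judgment_active//.
  by case: (s i v) (s i w) (t) vs => -[] [].
(* In a cascade the judgment is constant on [A t], so both likelihoods are 1. *)
suff llE t : cond_prob mu [set v | judgment (X v) (X v + llr (s i v) q) =
    judgment (X w) (X w + llr (s i w) q)]
    [set v | theta v = t /\ X v = X w] = 1.
  by rewrite !llE divr1 ln1.
rewrite /cond_prob -[RHS](divff (A0 t)); congr (fine (mu _) / _).
apply/seteqP; split=> v /=; first by case.
by move=> [vt vw]; split=> //; rewrite vw !judgment_absorbed.
Qed.

End Likelihood.

(** * Reduction of the cascade to the walk *)

Context (symmetric_prior : log_odds pi0 = 0).

Local Notation X := (public_log_odds mu pi0 q alpha theta c (fun i => s i)).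

Lemma public_log_odds_walk i w :
  X i w = walk q (llr (c w) alpha) (fun k => s k w) i.
Proof.
elim: i w => [|i IH] w /=; first by rewrite symmetric_prior add0r.
rewrite judgment_llrE; first by rewrite IH.
(* The induction hypothesis, valid at every sample point, shows that [X i] depends only on [c] and
   the first [i] private signals, as [judgment_llrE] requires. *)
move=> v v' vv'; rewrite !IH.
rewrite (_ : c v = c v'); last exact: (vv' 0%N).
by apply: eq_walk => k ki; exact: (vv' k.+1).
Qed.

Lemma correct_cascadeE w :
  correct_cascade mu pi0 q alpha theta c (fun i => s i) w <->
  rises q (llr (hit 0 w) alpha) (fun k => hit k.+1 w).
Proof.
rewrite /correct_cascade /cascade_direction /=.
have -> : (fun i => Num.sg (X i w)) =
    (fun i => Num.sg (walk q (llr (c w) alpha) (fun k => s k w) i)).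
  by apply/funext => i; rewrite public_log_odds_walk.
(* The target is [1] or [- 1], so the default direction [0] never counts as correct. *)
have sg0 : 2 * (theta w)%:R - 1 != 0 :> R.
  by apply/eqP; case: (theta w) => /= ?; lra.
rewrite limn_neq0P//.
rewrite /rises /hit /=; case: (theta w) => /=.
  rewrite (_ : 2 * 1 - 1 = 1); last by ring.
  have -> : (fun k => s k w == true) = (fun k => s k w).
    by apply/funext => k; rewrite eqb_id.
  by rewrite eqb_id.
rewrite (_ : 2 * 0 - 1 = - 1); last by ring.
have -> : (fun k => s k w == false) = (fun k => ~~ s k w).
  by apply/funext => k; rewrite eqbF_neg.
rewrite eqbF_neg llr_negb.
(* For [theta = false] the walk driven by hits is the reflected public walk, and convergence to
   [- 1] becomes convergence to [1]. *)
have -> : (fun i => Num.sg (walk q (- llr (c w) alpha) (fun k => ~~ s k w) i)) =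
    \- (fun i => Num.sg (walk q (llr (c w) alpha) (fun k => s k w) i)).
  by apply/funext => i; rewrite walkN sgrN.
by split=> [/cvgN|/cvgN]; rewrite opprK// => /cvg_trans; apply.
Qed.

(** * Absorption probabilities *)

(** After a prefix event [P] on the first [m] hits, each alternation costs a factor [q (1 - q)] and
    the final correct signal a factor [q]; the series sums to [q / (1 - q (1 - q))]. The bound
    [0 < m] leaves the AI signal in the prefix, so all later hits have accuracy [q]. *)
Lemma pr_alternates m P : determined m P -> (0 < m)%N ->
  let F n := P `&` [set w | alternates (fun k => hit (m + k) w) n /\
                            hit (m + n.*2) w = true] in
  pr (\bigcup_n F n) = pr P * (q / (1 - q + q ^+ 2)).
Proof.
move=> Pm m0 F.
have /andP[q2 q1] := q_itv.
pose Q n := P `&` [set w | alternates (fun k => hit (m + k) w) n].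
have accm k : accuracy (m + k) = q by case: (m) m0.
have Qm n : determined (m + n.*2) (Q n).
  move=> w w' ww' hh [Pw alt]; split.
    by apply: Pm Pw => // i im; apply: hh; lia.
  by move=> k kn; rewrite -!hh; [exact: alt|lia|lia].
have prQ n : pr (Q n) = pr P * (q * (1 - q)) ^+ n.
  elim: n => [|n IH].
    by rewrite expr0 mulr1; congr pr; apply/seteqP; split=> w // [].
  have Q1m : determined (m + n.*2).+1
      (Q n `&` [set w | hit (m + n.*2) w = false]).
    move=> w w' ww' hh [Qw hw]; split; last by rewrite /= -hh.
    by apply: Qm Qw => // i im; apply: hh; lia.
  have [_ /(_ true)] := determined_indep Q1m.
  have [_ /(_ false) ->] := determined_indep (Qm n).
  rewrite IH -addnS !accm /= => prQ.
  rewrite exprS [RHS](_ : _ = q * ((1 - q) * (pr P * (q * (1 - q)) ^+ n))).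
    rewrite -prQ; congr pr; apply/seteqP; split=> w.
      by move=> [Pw /= /alternatesS[wn [w0 w1]]].
    by move=> [[[Pw wn] w0] w1]; split=> //; apply/alternatesS.
  by ring.
have FQ n : F n = Q n `&` [set w | hit (m + n.*2) w = true].
  by apply/seteqP; split=> w [] => [Pw [alt hw]|[Pw alt] hw].
rewrite (@pr_geometric _ _ _ mu F (pr P * q) (q * (1 - q))).
- by rewrite -mulrA; congr (_ * (_ / _)); ring.
- by apply/andP; split; nra.
- move=> n; rewrite FQ; apply: measurableI; last exact: measurable_hit.
  by have [] := determined_indep (Qm n).
(* Of two indices, the smaller demands a correct final hit at a position where the alternation of
   the larger demands a wrong one. *)
- apply: ltn_trivIset => n k kn; apply/seteqP; split=> w // [].
  by move=> [_ [_ wk]] [_ [/(_ k kn)[wk0 _] _]]; rewrite wk0 in wk.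
- move=> n; rewrite FQ; have [_ /(_ true) ->] := determined_indep (Qm n).
  by rewrite accm prQ /=; ring.
Qed.

Lemma pr_hit0 x : pr [set w | hit 0 w = x] = bern alpha x.
Proof.
have [_ /(_ x)] := @determined_indep 0 setT (fun _ _ _ _ => id).
by rewrite setTI => ->; rewrite /pr probability_setT /= mulr1.
Qed.

(** The starting point [+- L_alpha] is already absorbed, the case [alpha = q] included. *)
Lemma correct_cascade_ge (w : T) : q <= alpha ->
  correct_cascade mu pi0 q alpha theta c (fun i => s i) w <-> hit 0 w = true.
Proof.
move=> qa; rewrite correct_cascadeE.
have L0 := log_odds_gt0 q_itv.
have La : log_odds q <= log_odds alpha.
  move/andP: q_itv => [? ?]; move/andP: alpha_itv => [? ?].
  by rewrite le_log_odds//; lra.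
rewrite llrE; case: (hit 0 w); rewrite rises_absorbed.
- by split=> // _; lra.
- by rewrite ger0_norm; lra.
- by split=> // ?; lra.
- by rewrite normrN ger0_norm; lra.
Qed.

Lemma W_plusE : W_plus mu pi0 q alpha theta c (fun i => s i) =
  pr (correct_cascade mu pi0 q alpha theta c (fun i => s i) `&`
      [set w | hit 0 w = true]) / alpha.
Proof.
rewrite -[X in _ / X]/(bern alpha true) -pr_hit0.
rewrite /W_plus (_ : [set w | c w = theta w] = [set w | hit 0 w = true])//.
by apply/seteqP; split=> w /= /eqP.
Qed.

Lemma W_minusE : W_minus mu pi0 q alpha theta c (fun i => s i) =
  pr (correct_cascade mu pi0 q alpha theta c (fun i => s i) `&`
      [set w | hit 0 w = false]) / (1 - alpha).
Proof.
rewrite -[X in _ / X]/(bern alpha false) -pr_hit0.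
rewrite /W_minus (_ : [set w | c w <> theta w] = [set w | hit 0 w = false])//.
apply/seteqP; split=> w; rewrite /hit /=; first by move=> /eqP/negbTE.
by move=> h /eqP; rewrite h.
Qed.

Lemma determined_hit n x : determined n.+1 [set w | hit n w = x].
Proof. by move=> w w' _ hh /= <-; rewrite hh. Qed.

Lemma W_plus_lt : alpha < q ->
  W_plus mu pi0 q alpha theta c (fun i => s i) = q / (1 - q + q ^+ 2).
Proof.
move=> aq.
have /andP[q2 q1] := q_itv; have /andP[a2 a1] := alpha_itv.
have e_itv : 0 < log_odds alpha < log_odds q.
  by rewrite log_odds_gt0// ltNge le_log_odds -?ltNge//; lra.
rewrite W_plusE; apply: (canLR (mulfK _)); first by apply/eqP => ?; lra.
rewrite mulrC -[X in X * _]/(bern alpha true) -pr_hit0.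
(* Here the prefix is the correct AI signal alone, with [m = 1]. *)
rewrite -(pr_alternates (@determined_hit 0 true))//; congr pr.
apply/seteqP; split=> w /=.
  move=> [/correct_cascadeE + h0]; rewrite h0 llrE risesE//.
  by move=> [n wn]; exists n.
move=> [n _ [h0 wn]]; split=> //; apply/correct_cascadeE.
by rewrite h0 llrE risesE//; exists n.
Qed.

Lemma W_minus_lt : alpha < q ->
  W_minus mu pi0 q alpha theta c (fun i => s i) = q ^+ 2 / (1 - q + q ^+ 2).
Proof.
move=> aq.
have /andP[q2 q1] := q_itv; have /andP[a2 a1] := alpha_itv.
have e_itv : 0 < log_odds alpha < log_odds q.
  by rewrite log_odds_gt0// ltNge le_log_odds -?ltNge//; lra.
rewrite W_minusE; apply: (canLR (mulfK _)); first by apply/eqP => ?; lra.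
(* The prefix has length 2: the wrong AI signal, then the correct private signal that lifts the walk
   from [- L_alpha] to [L_q - L_alpha]. *)
pose P := [set w | hit 0 w = false] `&` [set w | hit 1 w = true].
have P2 : determined 2 P.
  by move=> w w' _ hh [h0 h1]; split; rewrite /= -hh.
have prP : pr P = (1 - alpha) * q.
  have [_ /(_ true) ->] := determined_indep (@determined_hit 0 false).
  by rewrite pr_hit0 mulrC.
rewrite [RHS](_ : _ = pr P * (q / (1 - q + q ^+ 2))); last first.
  by rewrite prP expr2; ring.
rewrite -(pr_alternates P2)//; congr pr; apply/seteqP; split=> w /=.
  move=> [/correct_cascadeE + h0]; rewrite h0 llrE rises_opp//.
  by move=> [h1 [n wn]]; exists n.
move=> [n _ [[h0 h1] wn]]; split=> //; apply/correct_cascadeE.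
by rewrite h0 llrE rises_opp//; split=> //; exists n.
Qed.

End Signals.

Theorem proposition9 (d : measure_display) (T : measurableType d)
    (R : realType) (mu : probability T R)
    (pi0 q alpha : R) (theta c : {RV mu >-> bool})
    (s : nat -> {RV mu >-> bool})
    (pi0_itv : 0 < pi0 < 1) (symmetric_prior : log_odds pi0 = 0)
    (q_itv : 2^-1 < q < 1) (alpha_itv : 2^-1 < alpha < 1)
    (signals : cascade_signals pi0 q alpha theta c s) :
  (W_plus mu pi0 q alpha theta c (fun i => s i),
   W_minus mu pi0 q alpha theta c (fun i => s i)) =
  if q <= alpha then (1, 0)
  else (q / (1 - q + q ^+ 2), q ^+ 2 / (1 - q + q ^+ 2)).
Proof.
case: leP => [qa|aq]; last first.
  congr pair; first exact: W_plus_lt signals _ aq.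
  exact: W_minus_lt signals _ aq.
have /andP[a2 a1] := alpha_itv.
(* The cascade is now correct exactly when the AI is, so the conditioning event of [W_plus] lies in
   the correct event and that of [W_minus] is disjoint from it. *)
have correctE := correct_cascade_ge pi0_itv q_itv alpha_itv signals
  symmetric_prior _ qa.
rewrite W_plusE// W_minusE//; congr pair.
  rewrite (_ : _ `&` _ = [set w | hit theta c s 0 w = true]).
    rewrite (pr_hit0 pi0_itv q_itv alpha_itv signals) /=.
    by rewrite divff// gt_eqF//; lra.
  by apply/seteqP; split=> w /=; [case|split=> //; apply/correctE].
rewrite (_ : _ `&` _ = set0) ?pr0 ?mul0r//.
by apply/seteqP; split=> w //= [/correctE ->].
Qed.
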